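(* There are exactly twelve monomial clones on $\mathbb{F}_4$, namely the pairwise distinct clones $\langle\{x_1\}\rangle$, $\langle\{x_1x_2^3\}\rangle$, $\langle\{x_1^2\}\rangle$, $\langle\{x_1^3\}\rangle$, $\langle\{x_1^2x_2^3\}\rangle$, $\langle\{x_1^2,x_1^3\}\rangle$, $\langle\{x_1^3x_2^3\}\rangle$, $\langle\{x_1x_2x_3x_4\}\rangle$, $\langle\{x_1x_2^3,x_1^3x_2^3\}\rangle$, $\langle\{x_1^2,x_1^3x_2^3\}\rangle$, $\langle\{x_1^2x_2^3,x_1^3x_2^3\}\rangle$, $\langle\{x_1x_2\}\rangle$, and the covering relations (Hasse diagram) of their inclusion order are exactly $\langle\{x_1\}\rangle\prec\langle\{x_1x_2^3\}\rangle$, $\langle\{x_1\}\rangle\prec\langle\{x_1^2\}\rangle$, $\langle\{x_1\}\rangle\prec\langle\{x_1^3\}\rangle$, $\langle\{x_1x_2^3\}\rangle\prec\langle\{x_1^2x_2^3\}\rangle$, $\langle\{x_1x_2^3\}\rangle\prec\langle\{x_1x_2^3,x_1^3x_2^3\}\rangle$, $\langle\{x_1x_2^3\}\rangle\prec\langle\{x_1x_2x_3x_4\}\rangle$, $\langle\{x_1^2\}\rangle\prec\langle\{x_1^2x_2^3\}\rangle$, $\langle\{x_1^2\}\rangle\prec\langle\{x_1^2,x_1^3\}\rangle$, $\langle\{x_1^3\}\rangle\prec\langle\{x_1^2,x_1^3\}\rangle$, $\langle\{x_1^3\}\rangle\prec\langle\{x_1^3x_2^3\}\rangle$, $\langle\{x_1^2,x_1^3\}\rangle\prec\langle\{x_1^2,x_1^3x_2^3\}\rangle$,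 $\langle\{x_1^3x_2^3\}\rangle\prec\langle\{x_1^2,x_1^3x_2^3\}\rangle$, $\langle\{x_1^3x_2^3\}\rangle\prec\langle\{x_1x_2^3,x_1^3x_2^3\}\rangle$, $\langle\{x_1^2x_2^3\}\rangle\prec\langle\{x_1^2x_2^3,x_1^3x_2^3\}\rangle$, $\langle\{x_1x_2^3,x_1^3x_2^3\}\rangle\prec\langle\{x_1^2x_2^3,x_1^3x_2^3\}\rangle$, $\langle\{x_1^2,x_1^3x_2^3\}\rangle\prec\langle\{x_1^2x_2^3,x_1^3x_2^3\}\rangle$, $\langle\{x_1^2x_2^3,x_1^3x_2^3\}\rangle\prec\langle\{x_1x_2\}\rangle$, $\langle\{x_1x_2x_3x_4\}\rangle\prec\langle\{x_1x_2\}\rangle$.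
   Context: Throughout $q=4$. $\mathbb{N}=\{1,2,\dots\}$, $\mathbb{N}_0=\mathbb{N}\cup\{0\}$, $\mathbb{F}_q$ is the field with $q$ elements. A monomial is a formal product $g=\prod_{i\in\mathbb{N}}x_i^{\alpha(i)}$ with $\alpha(i)\in\mathbb{N}_0$, finitely many but at least one $\alpha(i)$ nonzero (so $1$ is not a monomial); $\mathrm{mI}(g)$ is the largest $i$ with $\alpha(i)\neq0$, called the arity of $g$. For $n\ge\mathrm{mI}(g)$ the $n$-ary induced function is $g^{\mathbb{F}_q^n}\colon\mathbb{F}_q^n\to\mathbb{F}_q$, $(x_1,\dots,x_n)\mapsto\prod_{i=1}^nx_i^{\alpha(i)}$. Monomials $m_1,m_2$ are equivalent if the $\mathrm{mI}(m_1)$-ary induced function of $m_1$ equals the $\mathrm{mI}(m_2)$-ary induced function of $m_2$ (i.e. for each $i$ the exponents of $x_i$ in $m_1$ and $m_2$ are equal, or both positive and congruent modulo $q-1$). A clone on a set $A$ is a set of finitary operations on $A$ (of arities $\ge1$) containing all projections and closed under composition. A set $M$ of monomials is a monomial clone on $\mathbb{F}_q$ if $\{m^{\mathbb{F}_q^n}\mid m\in M,\ n\ge\mathrm{mI}(m)\}$ is a clone on $\mathbb{F}_q$ and $M$ is closed under equivalent monomials. For a set $M'$ of monomials, $\langle M'\rangle$ is the least monomial clone on $\mathbb{F}_q$ containing $M'$. Monomial clones are ordered by inclusion; $C\prec D$ means $C\subset D$ (proper inclusion) with no monomial clone strictly between. *)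

(* Defs.v *)
From HB Require Import structures.
From mathcomp Require Import all_boot all_order all_algebra.
From mathcomp Require Import finmap classical_sets cardinality monalg.

Set Implicit Arguments.
Unset Strict Implicit.
Unset Printing Implicit Defensive.

Local Open Scope classical_set_scope.

(* Variables are indexed from 0: the exponent of the variable usually written
   x_i (i >= 1) is the value of the exponent function at i - 1.  The empty
   product 1 is not a monomial. *)
Record monomial := Monomial {
  exponents :> {cmonom nat};
  exponents_neq0 : finsupp exponents != fset0 }.

HB.instance Definition _ := [isSub for exponents].
HB.instance Definition _ := [Choice of monomial by <:].

Fact mvar_subproof (i : nat) : finsupp (ucm i) != fset0.
Proof. by rewrite mdomU; apply/fset0Pn; exists i; rewrite inE. Qed.

Definition mvar (i : nat) : monomial := Monomial (mvar_subproof i).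

Fact mprod_subproof (g h : monomial) :
  finsupp (mmul (g : {cmonom nat}) h) != fset0.
Proof.
have /fset0Pn[i gi] := exponents_neq0 g.
by rewrite mdomD; apply/fset0Pn; exists i; rewrite inE gi.
Qed.

Definition mprod (g h : monomial) : monomial := Monomial (mprod_subproof g h).

(* The product of n copies of g, for n > 0; as 1 is not a monomial, the value
   at n = 0 is junk (it is g). *)
Definition mpow (g : monomial) (n : nat) : monomial := iterop n mprod g g.

Declare Scope monomial_scope.
Delimit Scope monomial_scope with mon.
Bind Scope monomial_scope with monomial.
Notation "g * h" := (mprod g h) : monomial_scope.
Notation "g ^+ n" := (mpow g n) : monomial_scope.

Definition mI (g : monomial) : nat := \max_(i <- finsupp g) i.+1.

Definition operation (A : Type) : Type := {n : nat & n.-tuple A -> A}.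

Definition arity (A : Type) (f : operation A) : nat := tag f.

Definition op (A : Type) (n : nat) (f : n.-tuple A -> A) : operation A :=
  Tagged (fun n => n.-tuple A -> A) f.

Definition projection (A : Type) (n : nat) (i : 'I_n) : operation A :=
  op (fun x : n.-tuple A => tnth x i).

Definition composition (A : Type) (n m : nat)
    (f : n.-tuple A -> A) (g : 'I_n -> m.-tuple A -> A) : operation A :=
  op (fun x : m.-tuple A => f [tuple g i x | i < n]).

Definition is_clone (A : Type) (C : set (operation A)) : Prop :=
  [/\ forall f, C f -> 0 < arity f,
      forall n (i : 'I_n), C (projection A i) &
      forall n m (f : n.-tuple A -> A) (g : 'I_n -> m.-tuple A -> A),
        C (op f) -> (forall i, C (op (g i))) -> C (composition f g)].

(* Only meaningful for mI g <= n: otherwise variables of g are dropped. *)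
Definition induced (F : finFieldType) (n : nat) (g : monomial) : operation F :=
  op (fun x : n.-tuple F => \prod_(i < n) tnth x i ^+ g i)%R.

Definition mequiv (F : finFieldType) (g h : monomial) : Prop :=
  induced F (mI g) g = induced F (mI h) h.

Definition induced_set (F : finFieldType) (M : set monomial) :
    set (operation F) :=
  [set f | exists g n, [/\ M g, mI g <= n & f = induced F n g]].

Definition monomial_clone (F : finFieldType) (M : set monomial) : Prop :=
  is_clone (induced_set M : set (operation F)) /\
  (forall g h, M g -> mequiv F g h -> M h).

(* [smallest] is the intersection of all monomial clones containing M, which
   is itself a monomial clone. *)
Definition generated (F : finFieldType) (M : set monomial) : set monomial :=
  smallest (monomial_clone F) M.

Definition covers (F : finFieldType) (C D : set monomial) : Prop :=
  [/\ monomial_clone F C, monomial_clone F D, C `<` D &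
      ~ exists E, [/\ monomial_clone F E, C `<` E & E `<` D]].

Definition x1 : monomial := mvar 0.
Definition x2 : monomial := mvar 1.
Definition x3 : monomial := mvar 2.
Definition x4 : monomial := mvar 3.

Definition generators : 12.-tuple (seq monomial) :=
  [tuple [:: x1];
         [:: x1 * x2 ^+ 3];
         [:: x1 ^+ 2];
         [:: x1 ^+ 3];
         [:: x1 ^+ 2 * x2 ^+ 3];
         [:: x1 ^+ 2; x1 ^+ 3];
         [:: x1 ^+ 3 * x2 ^+ 3];
         [:: x1 * x2 * x3 * x4];
         [:: x1 * x2 ^+ 3; x1 ^+ 3 * x2 ^+ 3];
         [:: x1 ^+ 2; x1 ^+ 3 * x2 ^+ 3];
         [:: x1 ^+ 2 * x2 ^+ 3; x1 ^+ 3 * x2 ^+ 3];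
         [:: x1 * x2]]%mon.

(* The pair (s, t) stands for: the clone generated by t covers the clone
   generated by s. *)
Definition hasse : seq (seq monomial * seq monomial) :=
  [:: ([:: x1], [:: x1 * x2 ^+ 3]);
      ([:: x1], [:: x1 ^+ 2]);
      ([:: x1], [:: x1 ^+ 3]);
      ([:: x1 * x2 ^+ 3], [:: x1 ^+ 2 * x2 ^+ 3]);
      ([:: x1 * x2 ^+ 3], [:: x1 * x2 ^+ 3; x1 ^+ 3 * x2 ^+ 3]);
      ([:: x1 * x2 ^+ 3], [:: x1 * x2 * x3 * x4]);
      ([:: x1 ^+ 2], [:: x1 ^+ 2 * x2 ^+ 3]);
      ([:: x1 ^+ 2], [:: x1 ^+ 2; x1 ^+ 3]);
      ([:: x1 ^+ 3], [:: x1 ^+ 2; x1 ^+ 3]);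
      ([:: x1 ^+ 3], [:: x1 ^+ 3 * x2 ^+ 3]);
      ([:: x1 ^+ 2; x1 ^+ 3], [:: x1 ^+ 2; x1 ^+ 3 * x2 ^+ 3]);
      ([:: x1 ^+ 3 * x2 ^+ 3], [:: x1 ^+ 2; x1 ^+ 3 * x2 ^+ 3]);
      ([:: x1 ^+ 3 * x2 ^+ 3], [:: x1 * x2 ^+ 3; x1 ^+ 3 * x2 ^+ 3]);
      ([:: x1 ^+ 2 * x2 ^+ 3], [:: x1 ^+ 2 * x2 ^+ 3; x1 ^+ 3 * x2 ^+ 3]);
      ([:: x1 * x2 ^+ 3; x1 ^+ 3 * x2 ^+ 3],
       [:: x1 ^+ 2 * x2 ^+ 3; x1 ^+ 3 * x2 ^+ 3]);
      ([:: x1 ^+ 2; x1 ^+ 3 * x2 ^+ 3],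
       [:: x1 ^+ 2 * x2 ^+ 3; x1 ^+ 3 * x2 ^+ 3]);
      ([:: x1 ^+ 2 * x2 ^+ 3; x1 ^+ 3 * x2 ^+ 3], [:: x1 * x2]);
      ([:: x1 * x2 * x3 * x4], [:: x1 * x2])]%mon.

(* Main.v *)
Require Import Defs.
From HB Require Import structures.
From mathcomp Require Import all_boot all_order all_algebra all_field.
From mathcomp Require Import finmap classical_sets cardinality monalg.
From mathcomp Require Import boolp zify.

(** In a field with four elements x^4 = x and some element has order 3, so that
    an exponent only matters through its residue modulo 3 and through being
    zero or not ([eqexpP]).  Composition of induced functions thus becomes
    arithmetic on exponents, and a set of monomials is a monomial clone exactly
    when it contains the variables and is stable under substitution, up to this
    congruence of exponents ([monomial_cloneP]).

    Call a variable of a monomial light when its exponent is not divisible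
    by 3.  Sort the monomials into eight kinds, represented by x1, x1 x2^3,
    x1^2, x1^2 x2^3, x1^3, x1^3 x2^3, x1 x2 x3 x4 and x1 x2.  With at most one
    light variable, the kind records the residue of the light exponent, if
    there is one, and whether other variables occur; with two or more light
    variables it records whether the degree is 1 modulo 3.  A
    substitution-closed set contains a monomial if and only if it contains the
    representative of its kind ([closedP]).  From the monomial to the
    representative, one merges variables; the point is that two or more light
    variables can always be merged into exactly two ([closed_split_light]).
    From the representative to the monomial, x1 x2^3 and x1^3 x2^3 append
    cubes of variables one by one, x1 x2 builds all products, and x1 x2 x3 x4
    builds all products of 1 modulo 3 variables.

    A closed set is therefore a set of kinds.  A few substitutions relate the
    representatives: for instance x1^2 x2^3 is available exactly when x1 x2^3
    and x1^2 are, and x1 x2 x3 x4 together with x1^2 or x1^3 gives everything.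
    Only twelve sets of kinds obey these relations ([subst_closed_kindset]),
    and all twelve are closed, being intersections of six sets that are given
    by visibly preserved properties ([kindsets_closed]).  The generators and
    the Hasse diagram are then read off by comparing twelve finite sets. *)

Set Implicit Arguments.
Unset Strict Implicit.
Unset Printing Implicit Defensive.

Import GRing.Theory.

Local Open Scope classical_set_scope.

Implicit Types g h : monomial.

(** * Exponents of monomials *)

(* Otherwise simplification unfolds products before exponent lemmas apply. *)
Arguments exponents : simpl never.
Arguments mpow : simpl never.

Lemma mvarE i j : mvar i j = (i == j).
Proof. exact: cmU. Qed.

Lemma mprodE g h j : (g * h)%mon j = g j + h j.
Proof. exact: cmM. Qed.

Lemma mpowE g n j : 0 < n -> (g ^+ n)%mon j = n * g j.
Proof.
case: n => // n _; rewrite /mpow; elim: n => [|n IHn]; first by rewrite mul1n.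
by rewrite iteropS iterS mprodE -(iteropS g) IHn mulSn.
Qed.

Lemma ltn_mI g i : g i != 0 -> i < mI g.
Proof.
move=> gi; rewrite /mI (big_fsetD1 i) ?mem_finsupp //=.
by rewrite leq_max leqnn.
Qed.

Lemma mI_geP g n : reflect (forall i, n <= i -> g i = 0) (mI g <= n).
Proof.
apply: (iffP idP) => [gn i ni | gn].
  apply/eqP; apply: contraLR ni; rewrite -ltnNge => /ltn_mI ig.
  exact: leq_trans ig gn.
rewrite /mI; apply/bigmax_leqP_seq => i; rewrite mem_finsupp => gi _.
by rewrite ltnNge; apply: contra gi => /gn ->.
Qed.

Lemma mI_default g i : mI g <= i -> g i = 0.
Proof. by move: i; apply/mI_geP. Qed.

Lemma monomial_neq0 g : exists i, g i != 0.
Proof.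
by have /fset0Pn[i] := exponents_neq0 g; rewrite mem_finsupp => gi; exists i.
Qed.

Lemma mI_gt0 g : 0 < mI g.
Proof. by have [i /ltn_mI] := monomial_neq0 g; apply: leq_ltn_trans. Qed.

(** The product of the variables with indices in [i :: l]; the head is kept apart
    because the empty product is not a monomial. *)
Definition mlist (i : nat) (l : seq nat) : monomial :=
  foldr (fun j g => mprod (mvar j) g) (mvar i) l.

Lemma mlistE i l j : mlist i l j = count_mem j (i :: l).
Proof.
elim: l => [|k l /= IHl] /=; first by rewrite mvarE; lia.
by rewrite mprodE mvarE IHl; lia.
Qed.

Definition expand (f : nat -> nat) (n : nat) : seq nat :=
  flatten [seq nseq (f i) i | i <- iota 0 n].

Lemma count_expand f n j : count_mem j (expand f n) = if j < n then f j else 0.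
Proof.
rewrite /expand; elim: n => // n IHn.
rewrite -addn1 iotaD map_cat flatten_cat count_cat IHn /= cats0 count_nseq /=.
rewrite addn1 ltnS add0n /=.
by case: (ltngtP j n) => [_|_|->]; rewrite ?mul1n ?addn0.
Qed.

Lemma size_expand f n : size (expand f n) = \sum_(i < n) f i.
Proof.
rewrite /expand; elim: n => [|n IHn]; first by rewrite big_ord0.
rewrite -addn1 iotaD map_cat flatten_cat size_cat IHn /= cats0 size_nseq add0n.
by rewrite addn1 big_ord_recr.
Qed.

Lemma exists_monomial (f : nat -> nat) n i :
  i < n -> f i != 0 ->
  exists h : monomial, forall j, h j = if j < n then f j else 0.
Proof.
move=> ltin fi; have := count_expand f n; case: (expand f n) => [|k l] E.
  by have := E i; rewrite ltin => /esym/eqP; rewrite (negPf fi).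
by exists (mlist k l) => j; rewrite mlistE.
Qed.

(** * Exponents with the same power map *)

(** The congruence of exponents under which x^a = x^b for all x in a field with
    four elements. *)
Definition eqexp (a b : nat) : bool :=
  ((a == 0) == (b == 0)) && (a %% 3 == b %% 3).

Lemma eqexpxx a : eqexp a a.
Proof. by rewrite /eqexp !eqxx. Qed.
#[local] Hint Resolve eqexpxx : core.

Section FourElements.

Variable F : finFieldType.
Hypothesis cardF : #|F| = 4.

Local Open Scope ring_scope.

Lemma expr4 (x : F) : x ^+ 4 = x.
Proof. by rewrite -{2}[x]expf_card cardF. Qed.

(** The multiplicative group has order 3, so any element of it other than 1
    generates it. *)
Lemma exists_generator : exists2 x : F, x != 0 & x != 1.
Proof.
have: ~~ ([set: F] \subset [set 0; 1])%SET.
  by apply/negP => /subset_leq_card; rewrite cardsT cardF cards2; case: (_ != _).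
case/subsetPn => x _; rewrite !inE negb_or => /andP[x0 x1].
by exists x.
Qed.

Lemma exprD3 (x : F) a : (0 < a)%N -> x ^+ (a + 3) = x ^+ a.
Proof. by case: a => // a _; rewrite addSn -addnS exprD expr4 -exprSr. Qed.

(** Positive exponents reduce to 1, 2 or 3, never to 0. *)
Lemma expr_mod (x : F) a : (0 < a)%N -> x ^+ a = x ^+ (a.-1 %% 3).+1.
Proof.
case: a => // a _; rewrite /= {1}(divn_eq a 3) addnC -addSn.
elim: (a %/ 3)%N => [|q IHq]; first by rewrite mul0n addn0.
by rewrite mulSnr addnA exprD3.
Qed.

Lemma eqexpP (a b : nat) : reflect (forall x : F, x ^+ a = x ^+ b) (eqexp a b).
Proof.
apply: (iffP idP) => [ab x | ab].
  have [a0|a0] := posnP a.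
    have b0 : b = 0%N by move: ab; rewrite /eqexp a0; lia.
    by rewrite a0 b0.
  have b0 : (0 < b)%N by move: ab; rewrite /eqexp; lia.
  rewrite (expr_mod _ a0) (expr_mod _ b0); congr (_ ^+ _).
  by move: ab; rewrite /eqexp; lia.
have /= := ab 0; rewrite !expr0n => /eqP.
case: (posnP a) => [->|a0]; case: (posnP b) => [->|b0]; rewrite ?eqxx //.
  by rewrite oner_eq0.
  by rewrite eq_sym oner_eq0.
(* 1, w and w^2 are pairwise distinct and w^3 = 1. *)
move=> _; have [w w0 w1] := exists_generator.
have := ab w; rewrite (expr_mod _ a0) (expr_mod _ b0).
have w3 : w ^+ 3 = 1 by apply: (mulfI w0); rewrite -exprS expr4 mulr1.
have w12 : w ^+ 2 != w.
  by rewrite -subr_eq0 -[X in _ - X]mulr1 -mulrBr mulf_neq0 // subr_eq0.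
have w21 : w ^+ 2 != 1.
  by apply: contra w1 => /eqP w21; rewrite -w3 exprS w21 mulr1.
have := ltn_pmod a.-1 (isT : 0 < 3)%N; have := ltn_pmod b.-1 (isT : 0 < 3)%N.
rewrite /eqexp; move Ea: (a.-1 %% 3)%N => a'; move Eb: (b.-1 %% 3)%N => b'.
case: a' Ea => [|[|[|]]] // Ea; case: b' Eb => [|[|[|]]] // Eb _ _;
  rewrite ?w3 ?expr1 => /eqP; rewrite ?(negPf w1) ?(negPf w12) ?(negPf w21)
    1?eq_sym ?(negPf w1) ?(negPf w12) ?(negPf w21) //; lia.
Qed.

(** The argument that is 1 outside a single coordinate isolates one exponent. *)
Lemma eqexp_prodP n (a b : nat -> nat) :
  (forall j, (j < n)%N -> eqexp (a j) (b j)) <->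
  (forall x : nat -> F, \prod_(j < n) x j ^+ a j = \prod_(j < n) x j ^+ b j).
Proof.
split=> [ab x | ab j jn].
  by apply: eq_bigr => j _; apply/eqexpP/ab.
have pick (c : nat -> nat) (x : F) :
    \prod_(i < n) (if val i == j then x else 1) ^+ c i = x ^+ c j.
  rewrite (bigD1 (Ordinal jn)) //= eqxx big1 ?mulr1 // => i.
  by rewrite -val_eqE /= => /negPf->; rewrite expr1n.
apply/eqexpP => x.
by rewrite -(pick a) -(pick b) (ab (fun i => if i == j then x else 1)).
Qed.

(** * Operations induced by monomials *)

(** Evaluating at an infinite sequence makes sense without knowing the arity, so
    that operations of a priori different arities can be compared without
    casts between types of tuples. *)
Definition eval (x : nat -> F) (f : operation F) : F :=
  tagged f [tuple x i | i < arity f].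

Lemma eval_op x n (f : n.-tuple F -> F) : eval x (op f) = f [tuple x i | i < n].
Proof. by []. Qed.

Lemma eval_induced x n g : eval x (induced F n g) = \prod_(i < n) x i ^+ g i.
Proof. by apply: eq_bigr => i _; rewrite tnth_mktuple. Qed.

Lemma eval_inj n (f g : n.-tuple F -> F) :
  (forall x, eval x (op f) = eval x (op g)) -> f = g.
Proof.
move=> fg; apply/funext => t.
have -> : t = [tuple nth 0 t i | i < n].
  by apply: eq_from_tnth => i; rewrite tnth_mktuple (tnth_nth 0).
exact: fg (nth 0 t).
Qed.

Lemma induced_ext n (f : n.-tuple F -> F) (g : monomial) :
  (forall x, eval x (op f) = \prod_(i < n) x i ^+ g i) -> op f = induced F n g.
Proof.
by move=> fE; congr op; apply: eval_inj => x; rewrite fE -eval_induced.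
Qed.

(** Substitution multiplies and adds exponents; everything else about clones
    reduces to this identity. *)
Lemma eval_composition (x : nat -> F) n m (g : monomial) (s : nat -> monomial)
    (f : n.-tuple F -> F) (fs : 'I_n -> m.-tuple F -> F) :
    op f = induced F n g -> (forall i, op (fs i) = induced F m (s i)) ->
  f [tuple fs i [tuple x j | j < m] | i < n] =
  \prod_(j < m) x j ^+ (\sum_(i < n) g i * s i j).
Proof.
move=> fE fsE; have -> : f = tagged (induced F n g).
  by apply: eval_inj => y; rewrite fE.
rewrite /=.
under eq_bigr => i _.
  rewrite tnth_mktuple -(eval_op x) fsE eval_induced -prodrXl.
  under eq_bigr => j _ do rewrite -exprM mulnC. over.
by rewrite exchange_big; apply: eq_bigr => j _; rewrite prodrXr.
Qed.

Lemma inducedP n m g h :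
  induced F n g = induced F m h <->
  n = m /\ forall i, (i < n)%N -> eqexp (g i) (h i).
Proof.
split=> [E | [<-{m} gh]].
  have nm : n = m by apply: (congr1 (@arity F) E).
  split=> //; apply/eqexp_prodP => x.
  by rewrite -(eval_induced x n g) E eval_induced -nm.
apply: induced_ext => x; rewrite -[op _]/(induced F n g) eval_induced.
by have /eqexp_prodP -> := gh.
Qed.

End FourElements.

(** * Monomial clones as substitution-closed sets *)

(** The sum is the exponent of the variable [j] in the monomial that [g] becomes
    when [s i] is substituted for the variable [i].  Membership is required for
    every [h] with congruent exponents, which covers equivalence of monomials as
    well. *)
Definition subst_closed (M : set monomial) : Prop :=
  (forall i, M (mvar i)) /\
  (forall n (g h : monomial) (s : nat -> monomial), mI g <= n -> M g ->
    (forall i, M (s i)) ->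
    (forall j, eqexp (h j) (\sum_(i < n) g i * s i j)) -> M h).

Lemma sum_pick (f : nat -> nat) n j :
  \sum_(i < n) f i * (val i == j) = if j < n then f j else 0.
Proof.
case: ltnP => jn; last first.
  by rewrite big1 // => i _; rewrite ltn_eqF ?muln0 // (leq_trans (ltn_ord i)).
rewrite (bigD1 (Ordinal jn)) //= eqxx muln1 big1 ?addn0 // => i.
by rewrite -val_eqE /= => /negPf->; rewrite muln0.
Qed.

Section Clones.

Variable F : finFieldType.
Hypothesis cardF : #|F| = 4.

Lemma mequivP g h : mequiv F g h <-> forall i, eqexp (g i) (h i).
Proof.
split=> [/(inducedP cardF)[gh E] i | E].
  have [ig|gi] := ltnP i (mI g); first exact: E.
  by rewrite !mI_default // -gh.
apply/(inducedP cardF); split=> [|i _ //].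
have E0 i : (g i == 0) = (h i == 0) by have /andP[/eqP] := E i.
have le_mI (a b : monomial) : (forall i, a i == 0 = (b i == 0)) -> mI a <= mI b.
  move=> ab; apply/mI_geP => i bi; apply/eqP; rewrite ab; apply/eqP.
  by move: i bi; apply/mI_geP.
by apply/eqP; rewrite eqn_leq !le_mI // => i; rewrite E0.
Qed.

(** Membership in the induced set only provides some monomial of the set with the
    same function, and closure under equivalence recovers the given one. *)
Lemma induced_setP (M : set monomial) n g :
  monomial_clone F M -> mI g <= n ->
  induced_set M (induced F n g) -> M g.
Proof.
case=> _ Mequiv /mI_geP gn [h [m [Mh /mI_geP hm /(inducedP cardF)[nm E]]]].
apply: (Mequiv h) => //; apply/mequivP => i.
have [ilt|ni] := ltnP i n; last by rewrite gn // hm // -nm.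
by move: (E i ilt); rewrite /eqexp; lia.
Qed.

(** The projection to the last of [i.+1] arguments puts the variable [i] in the
    set, and composing induced operations of a common large arity [m] performs
    a substitution. *)
Lemma monomial_clone_subst_closed (M : set monomial) :
  monomial_clone F M -> subst_closed M.
Proof.
move=> MF; have [[_ Mproj Mcomp] _] := MF; split=> [i | n g h s gn Mg Ms E].
  have ig : mI (mvar i) <= i.+1.
    by apply/mI_geP => j ij; rewrite mvarE ltn_eqF.
  apply: (induced_setP MF ig).
  have <- : projection F (@ord_max i) = induced F i.+1 (mvar i).
    apply: induced_ext => x; rewrite eval_op tnth_mktuple.
    rewrite big_ord_recr big1 /= ?mvarE ?eqxx ?mul1r // => j _.
    by rewrite mvarE gtn_eqF.
  exact: Mproj.
pose m := maxn (mI h) (\max_(i < n) mI (s i)).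
have hm : mI h <= m by rewrite leq_maxl.
have sm (i : 'I_n) : mI (s i) <= m by rewrite leq_max (leq_bigmax i) orbT.
apply: (induced_setP MF hm).
have Cg : induced_set M (induced F n g) by exists g, n.
have Cs (i : 'I_n) : induced_set M (induced F m (s i)) by exists (s i), m.
have := Mcomp n m _ (fun i => tagged (induced F m (s i))) Cg Cs.
congr (induced_set M _); apply: induced_ext => x.
apply: etrans (@eval_composition F x n m g s _ _ erefl (fun=> erefl)) _.
pose e j := (\sum_(i < n) g i * s i j)%N.
by have /(eqexp_prodP cardF)/(_ x) -> : forall j, j < m -> eqexp (h j) (e j).
Qed.

(** Conversely an operation composed of induced ones is induced by the
    substituted monomial, which is not 1 because each of the substituted
    monomials involves a variable. *)
Lemma subst_closed_monomial_clone (M : set monomial) :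
  subst_closed M -> monomial_clone F M.
Proof.
move=> [Mvar Msub]; split; last first.
  move=> g h Mg /mequivP gh; apply: (Msub (mI g) g h mvar) => // j.
  under eq_bigr => i _ do rewrite mvarE.
  rewrite sum_pick; have := gh j; case: ltnP; first by rewrite /eqexp; lia.
  by move/mI_default ->; rewrite /eqexp; lia.
split.
- by move=> _ [g [n [_ gn ->]]]; apply: leq_trans (mI_gt0 g) gn.
- move=> n i; exists (mvar i), n; split=> //.
    apply/mI_geP => j nj; rewrite mvarE ltn_eqF //; exact: leq_trans nj.
  apply: induced_ext => x; rewrite eval_op tnth_mktuple.
  rewrite (bigD1 i) //= big1 ?mvarE ?eqxx ?mulr1 // => j.
  by rewrite mvarE eq_sym -val_eqE => /negPf ->.
move=> n m f gs [g [n' [Mg gn fE]]] Cgs.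
have nn' : n = n' by exact: (congr1 (@arity F) fE).
rewrite -{n'}nn' in gn fE.
have {Cgs} /fin_all_exists[s sP] (i : 'I_n) : exists t : monomial,
    [/\ M t, mI t <= m & op (gs i) = induced F m t].
  have [t [m' [Mt tm E]]] := Cgs i; exists t.
  have mm' : m = m' by exact: (congr1 (@arity F) E).
  by rewrite -mm' in tm E.
(* Beyond the arity any member of M can be substituted. *)
pose s' i := oapp s (mvar 0) (insub i).
have s'E (i : 'I_n) : s' i = s i by rewrite /s' valK.
pose e j := \sum_(i < n) g i * s' i j.
have [i gi] := monomial_neq0 g; have ig := leq_trans (ltn_mI gi) gn.
have [j sj] := monomial_neq0 (s (Ordinal ig)).
have jm : j < m by apply: leq_trans (ltn_mI sj) _; case: (sP (Ordinal ig)).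
have [|h hE] := @exists_monomial e m j jm.
  rewrite /e (bigD1 (Ordinal ig)) //= (s'E (Ordinal ig)) addn_eq0 muln_eq0.
  by rewrite (negPf gi) (negPf sj).
exists h, m; split.
- apply: (Msub n g h s') => // [k | k].
    by rewrite /s'; case: insub => //= k'; case: (sP k').
  rewrite hE; case: ltnP => km; rewrite /eqexp ?eqxx // big1 // => l _.
  by rewrite s'E; case: (sP l) => _ /mI_geP -> //; rewrite muln0.
- by apply/mI_geP => k mk; rewrite hE ltnNge mk.
apply: induced_ext => x.
have gsE i' : op (gs i') = induced F m (s' i') by rewrite s'E; case: (sP i').
apply: etrans (@eval_composition F x n m g s' _ _ fE gsE) _.
by apply: eq_bigr => k _; rewrite hE ltn_ord.
Qed.

(** The four-element field disappears from the problem here. *)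
Lemma monomial_cloneP (M : set monomial) :
  monomial_clone F M <-> subst_closed M.
Proof.
split; [exact: monomial_clone_subst_closed | exact: subst_closed_monomial_clone].
Qed.

End Clones.

(** * The eight kinds of monomials *)

(** The digits are the exponents of the representative. *)
Inductive kind := K1 | K13 | K2 | K23 | K3 | K33 | K1111 | K11.

Definition kind_index (k : kind) : nat :=
  match k with
  | K1 => 0 | K13 => 1 | K2 => 2 | K23 => 3 | K3 => 4 | K33 => 5 | K1111 => 6
  | K11 => 7
  end.

Lemma kind_indexK :
  cancel kind_index (nth K1 [:: K1; K13; K2; K23; K3; K33; K1111; K11]).
Proof. by case. Qed.

HB.instance Definition _ := Equality.copy kind (can_type kind_indexK).

Definition rep (k : kind) : monomial :=
  match k with
  | K1 => x1
  | K13 => x1 * x2 ^+ 3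
  | K2 => x1 ^+ 2
  | K23 => x1 ^+ 2 * x2 ^+ 3
  | K3 => x1 ^+ 3
  | K33 => x1 ^+ 3 * x2 ^+ 3
  | K1111 => x1 * x2 * x3 * x4
  | K11 => x1 * x2
  end%mon.

Definition rep_exponents (k : kind) : seq nat :=
  match k with
  | K1 => [:: 1]
  | K13 => [:: 1; 3]
  | K2 => [:: 2]
  | K23 => [:: 2; 3]
  | K3 => [:: 3]
  | K33 => [:: 3; 3]
  | K1111 => [:: 1; 1; 1; 1]
  | K11 => [:: 1; 1]
  end.

Lemma repE k j : rep k j = nth 0 (rep_exponents k) j.
Proof.
by case: k; rewrite /= ?(mprodE, mpowE, mvarE) //; case: j => [|[|[|[|j]]]];
  rewrite /= ?nth_nil.
Qed.

Lemma mI_rep k : mI (rep k) = size (rep_exponents k).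
Proof.
apply/eqP; rewrite eqn_leq; apply/andP; split.
  by apply/mI_geP => i ki; rewrite repE nth_default.
suff: (size (rep_exponents k)).-1 < mI (rep k) by case: k.
by apply: ltn_mI; rewrite repE; case: k.
Qed.

Definition light (g : monomial) : seq nat :=
  [seq i <- iota 0 (mI g) | ~~ (3 %| g i)].

Definition msupport (g : monomial) : seq nat :=
  [seq i <- iota 0 (mI g) | g i != 0].

Definition degree (g : monomial) : nat := \sum_(i < mI g) g i.

Definition kind_of (g : monomial) : kind :=
  let unary := size (msupport g) == 1 in
  match light g with
  | [::] => if unary then K3 else K33
  | [:: i] => if g i %% 3 == 1 then if unary then K1 else K13
              else if unary then K2 else K23
  | _ => if degree g %% 3 == 1 then K1111 else K11
  end.

Lemma kind_of_rep : cancel rep kind_of.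
Proof.
move=> k; rewrite /kind_of.
have -> : degree (rep k) = sumn (rep_exponents k).
  rewrite /degree mI_rep sumnE (big_nth 0) big_mkord.
  by apply: eq_bigr => i _; rewrite repE.
have -> : msupport (rep k) =
    [seq i <- iota 0 (size (rep_exponents k)) | nth 0 (rep_exponents k) i != 0].
  by rewrite /msupport mI_rep; apply: eq_filter => i; rewrite repE.
have -> : light (rep k) =
    [seq i <- iota 0 (size (rep_exponents k))
    | ~~ (3 %| nth 0 (rep_exponents k) i)].
  by rewrite /light mI_rep; apply: eq_filter => i; rewrite repE.
by have := repE k; case: k => /= E; rewrite ?E.
Qed.

Lemma mem_light g i : (i \in light g) = ~~ (3 %| g i).
Proof.
rewrite mem_filter mem_iota /= add0n; case gi: (3 %| g i) => //=.
by apply: ltn_mI; apply: contraFneq gi => ->.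
Qed.

Lemma mem_support g i : (i \in msupport g) = (g i != 0).
Proof.
rewrite mem_filter mem_iota /= add0n; case gi: (g i == 0) => //=.
by apply: ltn_mI; rewrite gi.
Qed.

Lemma light_uniq g : uniq (light g).
Proof. exact/filter_uniq/iota_uniq. Qed.

Lemma support_uniq g : uniq (msupport g).
Proof. exact/filter_uniq/iota_uniq. Qed.

(** The description of kinds by exponents, free of the enumerations through
    which [kind_of] computes. *)
Variant kind_spec (g : monomial) : kind -> Prop :=
| KindSpec1 i of g i %% 3 = 1 & (forall j, j != i -> g j = 0) :
    kind_spec g K1
| KindSpec13 i k of g i %% 3 = 1 & (forall j, j != i -> 3 %| g j)
    & k != i & g k != 0 : kind_spec g K13
| KindSpec2 i of g i %% 3 = 2 & (forall j, j != i -> g j = 0) :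
    kind_spec g K2
| KindSpec23 i k of g i %% 3 = 2 & (forall j, j != i -> 3 %| g j)
    & k != i & g k != 0 : kind_spec g K23
| KindSpec3 i of 3 %| g i & g i != 0 & (forall j, j != i -> g j = 0) :
    kind_spec g K3
| KindSpec33 i k of k != i & g i != 0 & g k != 0 & (forall j, 3 %| g j) :
    kind_spec g K33
| KindSpec1111 i k of k != i & ~~ (3 %| g i) & ~~ (3 %| g k)
    & degree g %% 3 = 1 : kind_spec g K1111
| KindSpec11 i k of k != i & ~~ (3 %| g i) & ~~ (3 %| g k)
    & degree g %% 3 != 1 : kind_spec g K11.

Lemma unaryP (g : monomial) i : g i != 0 ->
  if size (msupport g) == 1 then forall j, j != i -> g j = 0
  else exists2 j, j != i & g j != 0.
Proof.
move=> gi; have := mem_support g; have := support_uniq g.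
case: (msupport g) => [|a [|b s]] /=.
- by move=> _ /(_ i); rewrite gi.
- move=> _ E j ji; apply/eqP; have := E i; have := E j; rewrite gi !inE.
  by move=> Ej /eqP ia; rewrite -ia (negPf ji) in Ej; case: eqP Ej.
rewrite inE negb_or -andbA => /and3P[ab _ _] E.
have [ia|ai] := eqVneq a i; last by exists a; rewrite // -E inE eqxx.
by exists b; [rewrite -ia eq_sym | rewrite -E !inE eqxx orbT].
Qed.

Lemma kindP g : kind_spec g (kind_of g).
Proof.
rewrite /kind_of; have := mem_light g; have := light_uniq g.
case: (light g) => [|i [|k s]] /=.
- move=> _ E; have {}E j : 3 %| g j by apply/negPn; rewrite -E.
  have [i gi] := monomial_neq0 g; have := unaryP gi.
  by case: ifP => _; [exact: KindSpec3 | case=> k ki gk; exact: (KindSpec33 ki gi gk)].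
- move=> _ E; have gi : ~~ (3 %| g i) by rewrite -E inE eqxx.
  have gj j : j != i -> 3 %| g j by move=> ji; apply/negPn; rewrite -E inE.
  have gi0 : g i != 0 by apply: contraNneq gi => ->.
  have := unaryP gi0; case: (g i %% 3 =P 1) => g1; case: ifP => _ gu.
  + exact: KindSpec1 g1 gu.
  + by case: gu => k ki gk; apply: (KindSpec13 g1 gj ki gk).
  + by apply: (@KindSpec2 g i) => //; move: gi; lia.
  + by case: gu => k; apply: (@KindSpec23 g i) => //; move: gi; lia.
rewrite inE negb_or => /andP[/andP[ik _] _] E; rewrite eq_sym in ik.
have gi : ~~ (3 %| g i) by rewrite -E inE eqxx.
have gk : ~~ (3 %| g k) by rewrite -E !inE eqxx orbT.
case: eqP => [g1|/eqP g1]; first exact: KindSpec1111 ik gi gk g1.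
exact: KindSpec11 ik gi gk g1.
Qed.

(** * The twelve closed sets *)

Definition kindset (s : seq kind) : set monomial := [set g | kind_of g \in s].

(** A single light exponent is congruent to the degree. *)
Lemma degree_mod g i : (forall j, j != i -> 3 %| g j) -> degree g %% 3 = g i %% 3.
Proof.
move=> gj; have [ig|gi] := ltnP i (mI g).
  rewrite /degree (bigD1 (Ordinal ig)) //= -modnDmr.
  suff /eqP-> : 3 %| \sum_(j < mI g | j != Ordinal ig) g j by rewrite addn0.
  by apply: dvdn_sum => j; rewrite -val_eqE; apply: gj.
rewrite (mI_default gi) mod0n; apply/eqP; apply: dvdn_sum => j _; apply: gj.
by rewrite ltn_eqF // (leq_trans (ltn_ord j)).
Qed.

(** The following six equivalences restate membership in a set of kinds as a
    property of exponents that substitution preserves for a visible reason.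
    Each of the twelve closed sets but the largest is an intersection of such
    sets. *)
Lemma kind_unaryP g :
  (kind_of g \in [:: K1; K2; K3]) <-> exists i, forall j, j != i -> g j = 0.
Proof.
split; first by case: kindP => // i *; exists i.
case=> i gi; have two a b : b != a -> g a != 0 -> g b != 0 -> False.
  have only j : g j != 0 -> j = i by apply: contraNeq => /gi ->.
  by move=> ba /only ga /only gb; rewrite ga gb eqxx in ba.
by case: kindP => // a b *; case: (@two a b) => //; lia.
Qed.

Lemma kind_light1P g :
  (kind_of g \in [:: K1; K13; K2; K23; K3; K33]) <->
  forall i j, ~~ (3 %| g i) -> ~~ (3 %| g j) -> i = j.
Proof.
split.
  suff uniq_light i : (forall j, j != i -> 3 %| g j) ->
      forall j k, ~~ (3 %| g j) -> ~~ (3 %| g k) -> j = k.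
    case: kindP => // [i|i k|i|i k|i|i k] *; apply: (uniq_light i) => // l li;
      by auto; have -> : g l = 0 by auto.
  move=> gi j k; case: (eqVneq j i) => [->|/gi ->//].
  by case: (eqVneq k i) => [->|/gi ->].
by move=> gu; case: kindP => // i k ki gi gk; rewrite (gu _ _ gi gk) eqxx in ki.
Qed.

Lemma kind_degreeP g :
  (kind_of g \in [:: K1; K13; K1111]) <-> degree g %% 3 = 1.
Proof.
have multiples i :
    (forall j, j != i -> g j = 0) -> forall j, j != i -> 3 %| g j.
  by move=> gi j /gi ->.
case: kindP => // [i g1 /multiples/degree_mod|i k g1 /degree_mod|
  i g2 /multiples/degree_mod|i k g2 /degree_mod|i g3 _ /multiples/degree_mod
  |i k _ _ _ g3|i k _ _ _ /eqP]; try (by split=> //; lia).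
by have := @degree_mod g i (fun j _ => g3 j); have := g3 i; split=> //; lia.
Qed.

Lemma kind_one_lightP g :
  (kind_of g \in [:: K1; K13; K2; K23]) <->
  (forall i j, ~~ (3 %| g i) -> ~~ (3 %| g j) -> i = j) /\
  exists i, ~~ (3 %| g i).
Proof.
split.
  move=> gK; split; first by apply/kind_light1P; case: (kind_of g) gK.
  by case: kindP gK => // i *; exists i; lia.
case=> /kind_light1P + [l gl].
case: kindP => // [i gi _ gj|i k _ _ _ gj] _; last by rewrite gj in gl.
by case: (eqVneq l i) gl => [->|/gj -> //]; rewrite gi.
Qed.

Lemma kind_no2P g :
  (kind_of g \in [:: K1; K13; K3; K33]) <->
  (forall i j, ~~ (3 %| g i) -> ~~ (3 %| g j) -> i = j) /\
  forall i, g i %% 3 != 2.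
Proof.
split=> [gK|[/kind_light1P + gl]]; last first.
  by case: kindP => // i; have := gl i; lia.
split=> [|l]; first by apply/kind_light1P; case: (kind_of g) gK.
case: kindP gK => // [i g1 gj|i k g1 gj _ _|i g3 _ gj|i k _ _ _ g3] _;
  last by have := g3 l; lia.
all: by case: (eqVneq l i) => [->|/gj]; lia.
Qed.

Lemma kind_mult3P g :
  (kind_of g \in [:: K1; K2; K3; K33]) <->
  (forall i, 3 %| g i) \/ exists i, forall j, j != i -> g j = 0.
Proof.
split=> [|[g3|/kind_unaryP]]; last by case: (kind_of g).
  case: kindP => // [i _ gi|i _ gi|i _ _ gi|i k _ _ _ g3] _;
    by [left | right; exists i].
by case: kindP => // i *; have := g3 i; lia.
Qed.

Lemma degree_sum g n : mI g <= n -> \sum_(i < n) g i = degree g.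
Proof.
move=> gn; rewrite /degree (big_ord_widen n (fun i => g i) gn) [RHS]big_mkcond /=.
by apply: eq_bigr => i _; case: ltnP => // /mI_default.
Qed.

Lemma kind_of_mvar i : kind_of (mvar i) = K1.
Proof.
have only j : j != i -> mvar i j = 0 by rewrite mvarE eq_sym => /negPf ->.
have unary : kind_of (mvar i) \in [:: K1; K2; K3].
  by apply/kind_unaryP; exists i.
have : kind_of (mvar i) \in [:: K1; K13; K1111].
  apply/kind_degreeP; rewrite (@degree_mod _ i) ?mvarE ?eqxx // => j.
  by move=> /only ->.
by case: (kind_of _) unary.
Qed.

(** In this section [h] is, up to congruence of exponents, the monomial obtained
    from [g] by substituting [s i] for the variable [i]. *)
Section Substitution.

Variables (n : nat) (g h : monomial) (s : nat -> monomial).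
Hypothesis gn : mI g <= n.
Hypothesis hE : forall j, eqexp (h j) (\sum_(i < n) g i * s i j).

Let g0 i : n <= i -> g i = 0.
Proof. by move: i; apply/mI_geP. Qed.

Let h_mod j : h j %% 3 = (\sum_(i < n) g i * s i j) %% 3.
Proof. by have /andP[_ /eqP] := hE j. Qed.

Lemma subst_light j :
  ~~ (3 %| h j) -> exists2 i, ~~ (3 %| g i) & ~~ (3 %| s i j).
Proof.
rewrite /dvdn h_mod => hj.
suff /existsP[i /andP[gi si]] :
    [exists i : 'I_n, ~~ (3 %| g i) && ~~ (3 %| s i j)].
  by exists (val i).
apply: contraR hj; rewrite negb_exists => /forallP all3; apply: dvdn_sum => i _.
by move: (all3 i); rewrite negb_and !negbK => /orP[gi|si]; 
  [exact: dvdn_mulr | exact: dvdn_mull].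
Qed.

Lemma subst_mod i j :
  (forall k, k != i -> 3 %| g k) -> h j %% 3 = (g i * s i j) %% 3.
Proof.
move=> gi; rewrite h_mod; have [ilt|ni] := ltnP i n.
  rewrite (bigD1 (Ordinal ilt)) //= -modnDmr.
  suff /eqP-> : 3 %| \sum_(k < n | k != Ordinal ilt) g k * s k j by rewrite addn0.
  by apply: dvdn_sum => k; rewrite -val_eqE => ki; apply: dvdn_mulr; apply: gi.
rewrite (g0 ni) mul0n mod0n; apply/eqP; apply: dvdn_sum => k _.
by apply: dvdn_mulr; apply: gi; rewrite ltn_eqF // (leq_trans (ltn_ord k)).
Qed.

Lemma subst_unary i j :
  (forall k, k != i -> g k = 0) -> eqexp (h j) (g i * s i j).
Proof.
move=> gi; have := hE j; have [ilt|ni] := ltnP i n.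
  rewrite (bigD1 (Ordinal ilt)) //= big1 ?addn0 // => k.
  by rewrite -val_eqE => /gi ->.
rewrite (g0 ni) big1 // => k _.
by rewrite gi // ltn_eqF // (leq_trans (ltn_ord k)).
Qed.

(** Modulo 3, the degree of [h] is the sum of the degrees of the [s i] weighted by the
    exponents of [g]. *)
Lemma subst_degree :
  (forall i, degree (s i) %% 3 = 1) -> degree h %% 3 = degree g %% 3.
Proof.
move=> s1; pose m := maxn (mI h) (\max_(i < n) mI (s i)).
have hm : mI h <= m by rewrite leq_maxl.
have sm (i : 'I_n) : mI (s i) <= m by rewrite leq_max (leq_bigmax i) orbT.
rewrite -(degree_sum hm) -(degree_sum gn) -modn_summ.
under eq_bigr do rewrite h_mod.
rewrite modn_summ exchange_big /= -modn_summ -[RHS]modn_summ; congr (_ %% _).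
apply: eq_bigr => i _.
by rewrite -big_distrr /= (degree_sum (sm i)) -modnMmr s1 muln1.
Qed.

Lemma subst_light1 :
  (forall i j, ~~ (3 %| g i) -> ~~ (3 %| g j) -> i = j) ->
  (forall k i j, ~~ (3 %| s k i) -> ~~ (3 %| s k j) -> i = j) ->
  forall i j, ~~ (3 %| h i) -> ~~ (3 %| h j) -> i = j.
Proof.
move=> gu su i j /subst_light[k gk ski] /subst_light[l gl slj].
by rewrite (gu _ _ gl gk) in slj; apply: su ski slj.
Qed.

End Substitution.

Lemma kindset_closed (s : seq kind) :
  K1 \in s ->
  (forall n g h (t : nat -> monomial), mI g <= n -> kind_of g \in s ->
    (forall i, kind_of (t i) \in s) ->
    (forall j, eqexp (h j) (\sum_(i < n) g i * t i j)) -> kind_of h \in s) ->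
  subst_closed (kindset s).
Proof. by move=> s1 sub; split=> [i|]; rewrite /kindset /= ?kind_of_mvar. Qed.

Lemma closed_unary : subst_closed (kindset [:: K1; K2; K3]).
Proof.
apply: kindset_closed => // n g h s gn /kind_unaryP[i gi] sK hE.
have /kind_unaryP[k sk] := sK i; apply/kind_unaryP; exists k => j /sk sj.
by have := subst_unary gn hE j gi; rewrite sj muln0 /eqexp; lia.
Qed.

Lemma closed_light1 : subst_closed (kindset [:: K1; K13; K2; K23; K3; K33]).
Proof.
apply: kindset_closed => // n g h s gn /kind_light1P gK sK hE.
apply/kind_light1P; apply: (subst_light1 hE gK) => k.
exact/kind_light1P.
Qed.

Lemma closed_degree : subst_closed (kindset [:: K1; K13; K1111]).
Proof.
apply: kindset_closed => // n g h s gn /kind_degreeP gK sK hE.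
apply/kind_degreeP; rewrite (subst_degree gn hE) // => i.
exact/kind_degreeP.
Qed.

Lemma others_mod3 g i : (forall i j, ~~ (3 %| g i) -> ~~ (3 %| g j) -> i = j) ->
  ~~ (3 %| g i) -> forall j, j != i -> 3 %| g j.
Proof. by move=> gu gi j; apply: contraR => gj; apply/eqP; apply: gu. Qed.

Lemma closed_one_light : subst_closed (kindset [:: K1; K13; K2; K23]).
Proof.
apply: kindset_closed => // n g h s gn /kind_one_lightP[gu [i gi]] sK hE.
have /kind_one_lightP[_ [j sj]] := sK i.
apply/kind_one_lightP; split.
  by apply: (subst_light1 hE gu) => k; have /kind_one_lightP[] := sK k.
exists j; rewrite /dvdn (subst_mod gn hE j (others_mod3 gu gi)).
by rewrite -[_ == _]/(3 %| _) Euclid_dvdM // negb_or gi.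
Qed.

Lemma closed_no2 : subst_closed (kindset [:: K1; K13; K3; K33]).
Proof.
apply: kindset_closed => // n g h s gn /kind_no2P[gu g2] sK hE.
apply/kind_no2P; split=> [|j].
  by apply: (subst_light1 hE gu) => k; have /kind_no2P[] := sK k.
case hj: (3 %| h j); first by move: hj; lia.
have [i gi _] := subst_light hE (negbT hj).
have /kind_no2P[_ /(_ j)] := sK i.
rewrite (subst_mod gn hE j (others_mod3 gu gi)) -modnMml.
have -> : g i %% 3 = 1 by have := g2 i; move: gi; lia.
by rewrite mul1n.
Qed.

Lemma closed_mult3 : subst_closed (kindset [:: K1; K2; K3; K33]).
Proof.
apply: kindset_closed => // n g h s gn /kind_mult3P gK sK hE.
apply/kind_mult3P; case: gK => [g3|[i gi]].
  left=> j; apply/negPn/negP => /(subst_light hE)[i].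
  by rewrite g3.
have /kind_mult3P[s3|[k sk]] := sK i; [left=> j | right; exists k => j /sk sj].
  have /andP[_ /eqP] := subst_unary gn hE j gi.
  by rewrite /dvdn => ->; apply/eqP; apply/eqP; apply: dvdn_mull.
by have := subst_unary gn hE j gi; rewrite sj muln0 /eqexp; lia.
Qed.

Lemma closed_inter (s t u : seq kind) :
  (forall k, (k \in u) = (k \in s) && (k \in t)) ->
  subst_closed (kindset s) -> subst_closed (kindset t) ->
  subst_closed (kindset u).
Proof.
rewrite /kindset => uE [s1 ss] [t1 ts]; split=> [i|n g h f gn] /=; rewrite !uE.
  by apply/andP; split; [exact: s1 | exact: t1].
move=> /andP[gs gt] fu hE; apply/andP; split.
  by apply: ss gn gs _ hE => i; have := fu i; rewrite uE => /andP[].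
by apply: ts gn gt _ hE => i; have := fu i; rewrite uE => /andP[].
Qed.

(** Listed in the order of the tuple of generators; within each set the kinds are
    in the order of the type [kind], as filtering an enumeration of all kinds
    produces them. *)
Definition kindsets : seq (seq kind) :=
  [:: [:: K1]; [:: K1; K13]; [:: K1; K2]; [:: K1; K3];
      [:: K1; K13; K2; K23]; [:: K1; K2; K3]; [:: K1; K3; K33];
      [:: K1; K13; K1111]; [:: K1; K13; K3; K33]; [:: K1; K2; K3; K33];
      [:: K1; K13; K2; K23; K3; K33];
      [:: K1; K13; K2; K23; K3; K33; K1111; K11]].

(** The sets closed by a property of their own are the meet-irreducible elements
    of the lattice; the other ones are intersections. *)
Lemma kindsets_closed s : s \in kindsets -> subst_closed (kindset s).
Proof.
have c13 : subst_closed (kindset [:: K1; K13]).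
  by apply: closed_inter closed_degree closed_light1; case.
have c2 : subst_closed (kindset [:: K1; K2]).
  by apply: closed_inter closed_unary closed_one_light; case.
have c3 : subst_closed (kindset [:: K1; K3]).
  by apply: closed_inter closed_unary closed_no2; case.
have c1 : subst_closed (kindset [:: K1]).
  by apply: closed_inter c2 c3; case.
have c33 : subst_closed (kindset [:: K1; K3; K33]).
  by apply: closed_inter closed_mult3 closed_no2; case.
have call : subst_closed (kindset [:: K1; K13; K2; K23; K3; K33; K1111; K11]).
  by apply: kindset_closed => // n g h *; case: (kind_of h).
have := closed_unary; have := closed_light1; have := closed_degree.
have := closed_one_light; have := closed_no2; have := closed_mult3.
move=> ? ? ? ? ? ?; rewrite !inE.
by do 11! [case/orP; first by move/eqP->]; move/eqP->.
Qed.

(** * A closed set is determined by its kinds *)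

Section ClosedSet.

Variable M : set monomial.
Hypothesis Mclosed : subst_closed M.

Let Mvar i : M (mvar i) := Mclosed.1 i.

Lemma closed_subst_seq g (l : seq monomial) h :
  M g -> mI g <= size l -> (forall i, M (nth (mvar 0) l i)) ->
  (forall j, eqexp (h j) (\sum_(i < size l) g i * nth (mvar 0) l i j)) -> M h.
Proof. by move=> Mg gl Ml hE; apply: (Mclosed.2 _ _ _ _ gl Mg Ml hE). Qed.

Lemma closed_eqexp g h : M g -> (forall j, eqexp (h j) (g j)) -> M h.
Proof.
move=> Mg hg; apply: (Mclosed.2 _ _ h _ (leqnn _) Mg Mvar) => j.
under eq_bigr => i _ do rewrite mvarE.
by rewrite sum_pick; have := hg j; case: ltnP => // /mI_default ->.
Qed.

(** Renaming the variables in [p] to x1 and the other ones to x2 merges a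
    monomial into one in at most two variables. *)
Lemma closed_merge (p : pred nat) g h :
  M g -> eqexp (h 0) (\sum_(i < mI g | p i) g i) ->
  eqexp (h 1) (\sum_(i < mI g | ~~ p i) g i) ->
  (forall j, h j.+2 = 0) -> M h.
Proof.
move=> Mg h0 h1 h2.
apply: (Mclosed.2 _ _ h _ (leqnn _) Mg (fun i => Mvar (~~ p i))) => j.
under eq_bigr => i _ do rewrite mvarE.
case: j => [|[|j]]; rewrite ?h2.
- rewrite big_mkcond /= in h0.
  suff <- : \sum_(i < mI g) (if p i then g i else 0) =
    \sum_(i < mI g) g i * (~~ p i == 0 :> nat) by [].
  by apply: eq_bigr => i _; case: (p i); rewrite ?muln1 ?muln0.
- rewrite big_mkcond /= in h1.
  suff <- : \sum_(i < mI g) (if ~~ p i then g i else 0) =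
    \sum_(i < mI g) g i * (~~ p i == 1 :> nat) by [].
  by apply: eq_bigr => i _; case: (p i); rewrite ?muln1 ?muln0.
by rewrite big1 // => i _; case: (p i); rewrite muln0.
Qed.

(** Substitution into a representative, in a form that computes for concrete
    exponents. *)
Lemma closed_rep k (l : seq monomial) h :
  M (rep k) -> size l = size (rep_exponents k) ->
  foldr (fun g P => M g /\ P) True l ->
  (forall j, eqexp (h j) (sumn
    [seq p.1 * p.2 j | p : nat * monomial <- zip (rep_exponents k) l])) ->
  M h.
Proof.
move=> Mk lk Ml hE; apply: (closed_subst_seq Mk (l := l)).
- by rewrite mI_rep lk.
- move=> i {lk hE}; elim: l i Ml => [|g l IHl] [|i] //=; first by case.
  by case=> _; apply: IHl.
move=> j; suff <- :
  sumn [seq p.1 * p.2 j | p : nat * monomial <- zip (rep_exponents k) l] =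
  \sum_(i < size l) rep k i * nth (mvar 0) l i j by [].
rewrite sumnE big_map (big_nth (0, mvar 0)) big_mkord size_zip lk minnn.
by apply: eq_bigr => i _; rewrite nth_zip ?lk //= repE.
Qed.

Lemma closed_pow2 i : M (rep K2) -> M (mvar i ^+ 2)%mon.
Proof.
move=> M2; apply: (closed_rep M2 (l := [:: mvar i])) => //= j.
by rewrite mpowE // addn0.
Qed.

Lemma closed_pow3 i : M (rep K3) -> M (mvar i ^+ 3)%mon.
Proof.
move=> M3; apply: (closed_rep M3 (l := [:: mvar i])) => //= j.
by rewrite mpowE // addn0.
Qed.

(* Concrete monomials involve at most the first four variables, hence comparing
   their exponents is a check for the indices 0 to 3 and one beyond. *)
Ltac by_exponents :=
  case=> [|[|[|[|?]]]];
  rewrite ?repE /= ?(repE, mprodE, mpowE, mvarE, nth_nil).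

(** Together with the presence of x1, the implications [rep23_13] to
    [rep1111_3_11] and [closed_of11] are the only constraints on the kinds of a
    closed set. *)
Lemma rep23_13 : M (rep K23) -> M (rep K13).
Proof.
move=> M23; apply: (closed_rep M23 (l := [:: rep K23; mvar 1])) => //.
by by_exponents.
Qed.

Lemma rep23_2 : M (rep K23) -> M (rep K2).
Proof.
move=> M23; apply: (closed_rep M23 (l := [:: mvar 0; mvar 0])) => //.
by by_exponents.
Qed.

Lemma rep13_2_23 : M (rep K13) -> M (rep K2) -> M (rep K23).
Proof.
move=> M13 M2; apply: (closed_rep M13 (l := [:: rep K2; mvar 1])) => //.
by by_exponents.
Qed.

Lemma rep33_3 : M (rep K33) -> M (rep K3).
Proof.
move=> M33; apply: (closed_rep M33 (l := [:: mvar 0; mvar 0])) => //.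
by by_exponents.
Qed.

Lemma rep13_3_33 : M (rep K13) -> M (rep K3) -> M (rep K33).
Proof.
move=> M13 M3; apply: (closed_rep M13 (l := [:: rep K3; mvar 1])) => //.
by by_exponents.
Qed.

Lemma rep1111_13 : M (rep K1111) -> M (rep K13).
Proof.
move=> M1111.
apply: (closed_rep M1111 (l := [:: mvar 0; mvar 1; mvar 1; mvar 1])) => //.
by by_exponents.
Qed.

Lemma rep1111_2_11 : M (rep K1111) -> M (rep K2) -> M (rep K11).
Proof.
move=> M1111 M2; pose y i := (mvar i ^+ 2)%mon.
apply: (closed_rep M1111 (l := [:: y 0; y 0; y 1; y 1])) => //=.
  by do !split=> //; apply: closed_pow2.
by by_exponents.
Qed.

Lemma rep1111_3_11 : M (rep K1111) -> M (rep K3) -> M (rep K11).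
Proof.
move=> M1111 M3.
apply: (closed_rep M1111 (l := [:: mvar 0; mvar 1; rep K3; rep K3])) => //.
by by_exponents.
Qed.

Lemma closed_mlist11 i l : M (rep K11) -> M (mlist i l).
Proof.
move=> M11; elim: l => [|j l IHl]; first exact: Mvar.
apply: (closed_rep M11 (l := [:: mvar j; mlist i l])) => //= k.
by rewrite mprodE addn0 !mul1n.
Qed.

(** Substituting a product of 1 modulo 3 variables for one factor of
    x1 x2 x3 x4 lengthens it by three variables. *)
Lemma closed_mlist1111 i l :
  M (rep K1111) -> 3 %| size l -> M (mlist i l).
Proof.
move=> M1111; have [n] := ubnP (size l); elim: n l => // n IHn.
move=> [|a [|b [|c l]]];
  [by move=> _ _; apply: Mvar | by move=> _ | by move=> _ |].
rewrite /= ltnS => ln l3; have Ml : M (mlist i l) by apply: IHn; lia.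
apply: (closed_rep M1111 (l := [:: mvar a; mvar b; mvar c; mlist i l])) => //= k.
by rewrite !mprodE addn0 !mul1n.
Qed.

Lemma monomial_mlist g :
  exists i l, (size l).+1 = degree g /\ forall j, mlist i l j = g j.
Proof.
have := count_expand g (mI g); have := size_expand g (mI g).
case: (expand g (mI g)) => [|i l] El Ec.
  have [i gi] := monomial_neq0 g; have := Ec i.
  by rewrite ltn_mI // => /esym/eqP; rewrite (negPf gi).
exists i, l; split=> // j; rewrite mlistE Ec; case: ltnP => //.
by move/mI_default->.
Qed.

Lemma closed_of11 g : M (rep K11) -> M g.
Proof.
move=> M11; have [i [l [_ lE]]] := monomial_mlist g.
apply: (closed_eqexp (closed_mlist11 i l M11)) => j.
by rewrite lE.
Qed.

Lemma closed_of1111 g : M (rep K1111) -> degree g %% 3 = 1 -> M g.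
Proof.
move=> M1111 g1; have [i [l [lg lE]]] := monomial_mlist g.
have l3 : 3 %| size l by move: g1; rewrite -lg; lia.
apply: (closed_eqexp (closed_mlist1111 i M1111 l3)) => j.
by rewrite lE.
Qed.

(** Cubes of variables leave the residues modulo 3 of all exponents unchanged,
    and make variables occur. *)
Definition pad g (l : seq nat) : monomial :=
  foldr (fun j h => mprod h (mpow (mvar j) 3)) g l.

Lemma padE g l j : pad g l j = g j + 3 * count_mem j l.
Proof.
elim: l => [|k l IHl] /=; first by rewrite muln0 addn0.
by rewrite mprodE IHl mpowE // mvarE mulnDr -addnA (addnC (3 * count_mem j l)).
Qed.

Lemma closed_pad g l :
  (forall h k, M h -> (forall j, h j %% 3 = g j %% 3) -> M (h * mvar k ^+ 3)%mon) ->
  M g -> M (pad g l).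
Proof.
move=> step Mg; elim: l => //= k l IHl; apply: step => // j.
by rewrite padE; lia.
Qed.

Lemma closed_pad13 g l : M (rep K13) -> M g -> M (pad g l).
Proof.
move=> M13; apply: closed_pad => h k Mh _.
apply: (closed_rep M13 (l := [:: h; mvar k])) => // j /=.
by rewrite mprodE mpowE // addn0 mul1n.
Qed.

(** Here x1^3 x2^3 cubes what it pads, which is harmless when all exponents are
    multiples of 3. *)
Lemma closed_pad33 g l :
  M (rep K33) -> (forall j, 3 %| g j) -> M g -> M (pad g l).
Proof.
move=> M33 g3; apply: closed_pad => h k Mh hg.
apply: (closed_rep M33 (l := [:: h; mvar k])) => // j /=.
rewrite mprodE mpowE // addn0 /eqexp; have := hg j; have := g3 j.
by move: (h j) (g j) (mvar k j) => a b c; lia.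
Qed.

(** A monomial with at most one light variable is congruent to a power of one
    variable padded by its support. *)
Lemma closed_mpow_pad g i n :
  0 < n -> g i %% 3 = n %% 3 -> (forall j, j != i -> 3 %| g j) -> g i != 0 ->
  M (pad (mvar i ^+ n)%mon (msupport g)) -> M g.
Proof.
move=> n0 gi gj gi0 Mp; apply: (closed_eqexp Mp) => j.
rewrite padE count_uniq_mem ?support_uniq // mem_support mpowE // mvarE /eqexp.
by have [<-|ji] := eqVneq i j; [lia | have := gj j; rewrite eq_sym; lia].
Qed.

Lemma closed_of_rep g : M (rep (kind_of g)) -> M g.
Proof.
case: kindP => [i g1 gj|i k g1 gj _ _|i g2 gj|i k g2 gj _ _|i g3 gi gj
  |i k _ gi _ g3|i k _ _ _ g1|i k _ _ _ _] Mk.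
- apply: (closed_eqexp (Mvar i)) => j; rewrite mvarE /eqexp.
  by have [<-|ji] := eqVneq i j; [lia | rewrite gj // eq_sym].
- apply: (@closed_mpow_pad g i 1) => //; first by apply: contra_eqN g1 => /eqP->.
  by apply: closed_pad13 => //; apply: Mvar.
- apply: (closed_eqexp (closed_pow2 i Mk)) => j; rewrite mpowE // mvarE /eqexp.
  by have [<-|ji] := eqVneq i j; [lia | rewrite gj // eq_sym].
- apply: (@closed_mpow_pad g i 2) => //; first by apply: contra_eqN g2 => /eqP->.
  by apply: closed_pad13; [apply: rep23_13 | apply/closed_pow2/rep23_2].
- apply: (closed_eqexp (closed_pow3 i Mk)) => j; rewrite mpowE // mvarE /eqexp.
  by have [<-|ji] := eqVneq i j; [lia | rewrite gj // eq_sym].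
- apply: (@closed_mpow_pad g i 3) => //; first by have := g3 i; lia.
  apply: closed_pad33 => // [j|]; first by rewrite mpowE // dvdn_mulr.
  exact/closed_pow3/rep33_3.
- exact: closed_of1111.
exact: closed_of11.
Qed.

Definition mpow12 (a b : nat) : monomial := (mvar 0 ^+ a * mvar 1 ^+ b)%mon.

Lemma mpow12E a b j : 0 < a -> 0 < b -> mpow12 a b j = nth 0 [:: a; b] j.
Proof.
move=> a0 b0; rewrite mprodE !mpowE // !mvarE.
by case: j => [|[|j]]; rewrite /= ?nth_nil; lia.
Qed.

Lemma degreeID (p : pred nat) g :
  degree g = \sum_(i < mI g | p i) g i + \sum_(i < mI g | ~~ p i) g i.
Proof. by rewrite /degree (bigID (fun i : 'I__ => p i)). Qed.

Lemma closed_merge_light (p : pred nat) g :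
  M g -> ~~ (3 %| \sum_(i < mI g | p i) g i) ->
  ~~ (3 %| \sum_(i < mI g | ~~ p i) g i) ->
  exists a b, [/\ a \in [:: 1; 2], b \in [:: 1; 2],
    degree g %% 3 = (a + b) %% 3 & M (mpow12 a b)].
Proof.
rewrite (degreeID p).
move Ea: (\sum_(i < mI g | p i) g i) => a.
move Eb: (\sum_(i < mI g | ~~ p i) g i) => b Mg a3 b3.
have a0 : 0 < a %% 3 by rewrite lt0n.
have b0 : 0 < b %% 3 by rewrite lt0n.
exists (a %% 3), (b %% 3); split; last first.
- apply: (closed_merge (p := p) Mg); rewrite ?Ea ?Eb ?mpow12E //=.
  + by rewrite /eqexp; lia.
  + by rewrite /eqexp; lia.
  by move=> j; rewrite mpow12E //= nth_nil.
- by rewrite modnDm.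
- by rewrite !inE; move: (ltn_pmod b (isT : 0 < 3)); lia.
by rewrite !inE; move: (ltn_pmod a (isT : 0 < 3)); lia.
Qed.

(** Let r be the degree modulo 3.  Putting [i] alone on one side leaves a rest of
    residue r - g i, which vanishes only when g i = r, and similarly for [k].
    If both equal r, the side consisting of [i] and [k] has residue 2r and its
    complement - r, and r is not 0 because [i] is light. *)
Lemma closed_split_light g i k :
  M g -> k != i -> ~~ (3 %| g i) -> ~~ (3 %| g k) ->
  exists a b, [/\ a \in [:: 1; 2], b \in [:: 1; 2],
    degree g %% 3 = (a + b) %% 3 & M (mpow12 a b)].
Proof.
move=> Mg ki gi gk.
have lt_light j : ~~ (3 %| g j) -> j < mI g.
  by move=> gj; apply: ltn_mI; apply: contraNneq gj => ->.
have sum1 j : ~~ (3 %| g j) -> \sum_(l < mI g | val l == j) g l = g j.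
  by move=> /lt_light jg; rewrite (big_pred1 (Ordinal jg)).
have sum2 : \sum_(l < mI g | (val l == i) || (val l == k)) g l = g i + g k.
  rewrite (bigID (fun l : 'I__ => val l == i)) /=; congr (_ + _).
    rewrite -(sum1 i) //; apply: eq_bigl => l.
    by case: eqP; rewrite ?andbT ?andbF.
  rewrite -(sum1 k) //; apply: eq_bigl => l; have [->|] := eqVneq (val l) i.
    by rewrite andbF eq_sym (negPf ki).
  by rewrite andbT.
have := degreeID (pred1 i) g; have := degreeID (pred1 k) g.
have := degreeID (fun l => (l == i) || (l == k)) g.
rewrite sum2 /= !sum1 // => e2 ek ei.
have [ri|ri] := boolP (degree g %% 3 == g i %% 3); last first.
  by apply: (closed_merge_light (p := pred1 i)) => //; rewrite /= ?sum1 //; lia.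
have [rk|rk] := boolP (degree g %% 3 == g k %% 3); last first.
  by apply: (closed_merge_light (p := pred1 k)) => //; rewrite /= ?sum1 //; lia.
apply: (closed_merge_light (p := fun l => (l == i) || (l == k))) => //=;
  rewrite ?sum2; move: e2 ri rk gi gk; clear;
  by move: (degree g) (g i) (g k) (\sum_(_ < _ | _) _); lia.
Qed.

Lemma closed_mpow12 a b g1 g2 h :
  0 < a -> 0 < b -> M (mpow12 a b) -> M g1 -> M g2 ->
  (forall j, eqexp (h j) (a * g1 j + b * g2 j)) -> M h.
Proof.
move=> a0 b0 Mab Mg1 Mg2 hE.
apply: (closed_subst_seq Mab (l := [:: g1; g2])) => //=.
- apply/mI_geP => j; rewrite mpow12E //.
  by case: j => [|[|j]] // _; rewrite nth_default.
- by move=> [|[|j]] //=; rewrite nth_nil.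
by move=> j; rewrite !big_ord_recr big_ord0 /= !mpow12E.
Qed.

(** x1^2 x2^2 applied to itself and to x3^2 x4^2 has all four exponents equal
    to 4, which is congruent to 1. *)
Lemma rep1111_of_22 : M (mpow12 2 2) -> M (rep K1111).
Proof.
move=> M22; pose z := (mvar 2 ^+ 2 * mvar 3 ^+ 2)%mon.
have Mz : M z.
  apply: (closed_mpow12 _ _ M22 (Mvar 2) (Mvar 3)) => // j.
  by rewrite mprodE !mpowE.
apply: (closed_mpow12 _ _ M22 M22 Mz) => // j.
rewrite repE mpow12E // mprodE !mpowE // !mvarE.
by case: j => [|[|[|[|j]]]]; rewrite /= ?nth_nil.
Qed.

(** x1 x2^2 first gives x1^3 and x1 x2 x3, and x1 x2 x1^3 is congruent to
    x1 x2. *)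
Lemma rep11_of_12 : M (mpow12 1 2) -> M (rep K11).
Proof.
move=> M12; pose g := (mvar 0 * mvar 1 * mvar 2)%mon.
have M3 i : M (mvar i ^+ 3)%mon.
  apply: (closed_mpow12 _ _ M12 (Mvar i) (Mvar i)) => // j.
  by rewrite mpowE // -mulnDl.
have M2 i j : M (mvar i * mvar j ^+ 2)%mon.
  apply: (closed_mpow12 _ _ M12 (Mvar i) (Mvar j)) => // k.
  by rewrite mprodE mpowE // mul1n.
have Mg : M g.
  (* x1 x2^2 (x2 x3^2)^2 has the exponents 1, 4, 4. *)
  apply: (closed_mpow12 _ _ M12 (M2 0 1) (M2 1 2)) => // j.
  by rewrite !mprodE ?mpowE // !mvarE; case: j => [|[|[|j]]].
apply: (closed_subst_seq Mg (l := [:: mvar 0; mvar 1; mvar 0 ^+ 3]%mon)) => //=.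
- apply/mI_geP => -[|[|[|j]]] // _.
  by rewrite !mprodE !mvarE.
- by move=> [|[|[|j]]] //=; rewrite ?nth_nil //; apply: M3.
move=> j; rewrite !big_ord_recr big_ord0 /= !mprodE !mvarE.
by case: j => [|[|j]].
Qed.

Lemma closed_merge_others g i k :
  M g -> g i != 0 -> size (rep_exponents k) <= 2 -> eqexp (rep k 0) (g i) ->
  eqexp (rep k 1) (\sum_(j < mI g | j != i :> nat) g j) -> M (rep k).
Proof.
move=> Mg gi k2 k0 k1; apply: (closed_merge (p := pred1 i) Mg) => //= [|j].
  by rewrite (big_pred1 (Ordinal (ltn_mI gi))).
by rewrite repE nth_default // (leq_trans k2).
Qed.

Lemma rep_of_unary g i c k :
  M g -> rep_exponents k = [:: c] -> c != 0 -> g i != 0 -> g i %% 3 = c %% 3 ->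
  (forall j, j != i -> g j = 0) -> M (rep k).
Proof.
move=> Mg kc c0 gi gic gj; apply: (closed_merge_others Mg gi).
- by rewrite kc.
- by rewrite repE kc /= /eqexp gic eqxx (negPf gi) (negPf c0).
by rewrite repE kc big1 // => j /gj.
Qed.

Lemma rep_of_nonunary g i l c k :
  M g -> rep_exponents k = [:: c; 3] -> c != 0 -> g i != 0 ->
  g i %% 3 = c %% 3 -> (forall j, j != i -> 3 %| g j) -> l != i -> g l != 0 ->
  M (rep k).
Proof.
move=> Mg kc c0 gi gic gj li gl; apply: (closed_merge_others Mg gi).
- by rewrite kc.
- by rewrite repE kc /= /eqexp gic eqxx (negPf gi) (negPf c0).
have sum_neq0 : \sum_(j < mI g | j != i :> nat) g j != 0.
  by rewrite (bigD1 (Ordinal (ltn_mI gl))) //= addn_eq0 (negPf gl).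
have sum_mult3 : 3 %| \sum_(j < mI g | j != i :> nat) g j.
  by apply: dvdn_sum => j; apply: gj.
by rewrite repE kc /= /eqexp (negPf sum_neq0) (eqP sum_mult3).
Qed.

(** With at most one light variable, that variable or one of the occurring ones is
    kept and all other variables are merged.  With two light variables the
    degree modulo 3 decides which of x1 x2, x1 x2^2 and x1^2 x2^2 is obtained by
    merging, up to exchanging x1 and x2. *)
Lemma rep_of_closed g : M g -> M (rep (kind_of g)).
Proof.
have neq0 i c : g i %% 3 = c.+1 -> g i != 0 by case: (g i).
case: kindP => [i g1 gj|i l g1 gj li gl|i g2 gj|i l g2 gj li gl|i g3 gi gj
  |i l li gi gl g3|i l li gi gl gd|i l li gi gl gd] Mg.
- exact: Mvar.
- exact: (@rep_of_nonunary g i l 1 K13 Mg erefl isT (neq0 _ _ g1) g1 gj li gl).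
- exact: (@rep_of_unary g i 2 K2 Mg erefl isT (neq0 _ _ g2) g2 gj).
- exact: (@rep_of_nonunary g i l 2 K23 Mg erefl isT (neq0 _ _ g2) g2 gj li gl).
- exact: (@rep_of_unary g i 3 K3 Mg erefl isT gi (eqP g3) gj).
- exact: (@rep_of_nonunary g i l 3 K33 Mg erefl isT gi (eqP (g3 i)) (fun j _ => g3 j) li gl).
- have [a [b [aP bP gab Mab]]] := closed_split_light Mg li gi gl.
  apply: rep1111_of_22; move: aP bP gab Mab; rewrite gd !inE.
  by do 2! case/pred2P => ->.
have [a [b [aP bP gab Mab]]] := closed_split_light Mg li gi gl.
move: aP bP gab Mab; rewrite !inE; case/pred2P=> ->; case/pred2P=> -> gab Mab.
- apply: (closed_mpow12 _ _ Mab (Mvar 0) (Mvar 1)) => // j.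
  by rewrite mprodE !mul1n.
- exact: rep11_of_12.
- apply: rep11_of_12; apply: (closed_mpow12 _ _ Mab (Mvar 1) (Mvar 0)) => // j.
  by rewrite mpow12E // !mvarE; case: j => [|[|j]]; rewrite /= ?nth_nil.
by rewrite gab in gd.
Qed.

(** The two halves together reduce the classification to subsets of [kind]. *)
Lemma closedP g : M g <-> M (rep (kind_of g)).
Proof. by split; [exact: rep_of_closed | exact: closed_of_rep]. Qed.

End ClosedSet.

(** * Classification and Hasse diagram *)

(** The relations between the representatives leave twelve of the 256 sets of
    kinds. *)
Lemma subst_closed_kindset M :
  subst_closed M -> exists2 s, s \in kindsets & M = kindset s.
Proof.
move=> Mcl; pose p k := `[< M (rep k) >].
exists [seq k <- [:: K1; K13; K2; K23; K3; K33; K1111; K11] | p k]; last first.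
  apply/seteqP; split=> g; rewrite /kindset /mkset mem_filter.
    move=> /(closedP Mcl) Mg; apply/andP; split; first exact/asboolP.
    by case: (kind_of g).
  by move=> /andP[/asboolP Mg _]; apply/(closedP Mcl).
have r1 : p K1 by apply/asboolP; apply: Mcl.1.
have r2 : p K23 ==> p K13 && p K2.
  by apply/implyP => /asboolP Mk; apply/andP; split; apply/asboolP;
    [exact: rep23_13 | exact: rep23_2].
have r3 : p K13 && p K2 ==> p K23.
  by apply/implyP => /andP[/asboolP ? /asboolP ?]; apply/asboolP; exact: rep13_2_23.
have r4 : p K33 ==> p K3.
  by apply/implyP => /asboolP ?; apply/asboolP; exact: rep33_3.
have r5 : p K13 && p K3 ==> p K33.
  by apply/implyP => /andP[/asboolP ? /asboolP ?]; apply/asboolP; exact: rep13_3_33.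
have r6 : p K1111 ==> p K13.
  by apply/implyP => /asboolP ?; apply/asboolP; exact: rep1111_13.
have r7 : p K1111 && (p K2 || p K3) ==> p K11.
  apply/implyP => /andP[/asboolP ? /orP[] /asboolP ?]; apply/asboolP.
    exact: rep1111_2_11.
  exact: rep1111_3_11.
have r8 k : p K11 ==> p k.
  by apply/implyP => /asboolP ?; apply/asboolP; exact: closed_of11.
have := r8 K2; have := r8 K3; have := r8 K1111.
move: r1 r2 r3 r4 r5 r6 r7; rewrite /=.
by case: (p K1); case: (p K13); case: (p K2); case: (p K23); case: (p K3);
  case: (p K33); case: (p K1111); case: (p K11).
Qed.

(** Each kind contains its representative, so inclusion is decidable. *)
Lemma kindset_sub s t : kindset s `<=` kindset t <-> all [in t] s.
Proof.
split=> [st | /allP st g /=]; last exact: st.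
apply/allP => k ks; have := st (rep k).
by rewrite /kindset /= kind_of_rep; apply.
Qed.

Definition generator_kinds : seq (seq kind) :=
  [:: [:: K1]; [:: K13]; [:: K2]; [:: K3]; [:: K23]; [:: K2; K3]; [:: K33];
      [:: K1111]; [:: K13; K33]; [:: K2; K33]; [:: K23; K33]; [:: K11]].

Lemma generatorsE : generators = map (map rep) generator_kinds :> seq _.
Proof. by []. Qed.

Lemma nth_generators i :
  i < 12 -> nth [::] generators i = map rep (nth [::] generator_kinds i).
Proof. by move=> i12; rewrite generatorsE (nth_map [::]). Qed.

Definition psub (s t : seq kind) : bool := all [in t] s && ~~ all [in s] t.

Lemma kindset_proper s t : kindset s `<` kindset t <-> psub s t.
Proof.
split=> [[/kindset_sub st ts] | /andP[/kindset_sub st /negP ts]].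
  by rewrite /psub st; apply/negP => /kindset_sub.
by split=> // /kindset_sub.
Qed.

Definition cover (s t : seq kind) : bool :=
  psub s t && ~~ has (fun u => psub s u && psub u t) kindsets.

Definition hasse_index : seq (nat * nat) :=
  [:: (0, 1); (0, 2); (0, 3); (1, 4); (1, 8); (1, 7); (2, 4); (2, 5); (3, 5);
      (3, 6); (5, 9); (6, 9); (6, 8); (4, 10); (8, 10); (9, 10); (10, 11);
      (7, 11)].

Lemma hasseE :
  hasse = [seq (nth [::] generators e.1, nth [::] generators e.2)
          | e <- hasse_index].
Proof. by []. Qed.

(** Turns statements about the indices below 12 into computations. *)
Lemma ltn12_ind (P : nat -> bool) : all P (iota 0 12) -> forall i, i < 12 -> P i.
Proof. by move=> /allP allP i i12; apply: allP; rewrite mem_iota. Qed.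

Lemma cover_hasse i j : i < 12 -> j < 12 ->
  cover (nth [::] kindsets i) (nth [::] kindsets j) = ((i, j) \in hasse_index).
Proof.
move=> i12 j12; apply/eqP; move: j j12; apply: ltn12_ind; move: i i12.
exact: ltn12_ind.
Qed.

Section Final.

Variable F : finFieldType.
Hypothesis cardF : #|F| = 4.

Lemma monomial_clone_kindset M :
  monomial_clone F M <-> exists2 s, s \in kindsets & M = kindset s.
Proof.
rewrite (monomial_cloneP cardF); split; first exact: subst_closed_kindset.
by move=> [s sK ->]; apply: kindsets_closed.
Qed.

(** A closed set containing the generators is one of the twelve, and each of the
    twelve that contains the generators contains the whole of the corresponding
    set: a finite check. *)
Lemma generated_kindset i : i < 12 ->
  generated F [set` nth [::] generators i] = kindset (nth [::] kindsets i).
Proof.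
move=> i12; rewrite nth_generators //; apply/seteqP; split.
  apply: smallest_sub.
    by apply/monomial_clone_kindset; exists (nth [::] kindsets i); rewrite ?mem_nth.
  move=> _ /mapP[k ki ->]; rewrite /kindset /= kind_of_rep; apply: (allP _ k ki).
  by move: i i12 {k ki}; apply: ltn12_ind.
move=> g gi N [/monomial_clone_kindset[t tK ->] gent].
have : all [in t] (nth [::] generator_kinds i).
  apply/allP => k ki; have := gent (rep k) (map_f _ ki).
  by rewrite /kindset /= kind_of_rep.
suff /allP/(_ t tK)/implyP ti :
    all (fun t => all [in t] (nth [::] generator_kinds i) ==>
      all [in t] (nth [::] kindsets i)) kindsets.
  by move=> /ti/kindset_sub; apply.
by move: i i12 {gi gent}; apply: ltn12_ind.
Qed.

Lemma kindset_nth_inj i j : i < 12 -> j < 12 ->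
  kindset (nth [::] kindsets i) = kindset (nth [::] kindsets j) -> i = j.
Proof.
move=> i12 j12 ij; apply/eqP.
have /kindset_sub sub_ij :
    kindset (nth [::] kindsets i) `<=` kindset (nth [::] kindsets j).
  by rewrite ij.
have /kindset_sub sub_ji :
    kindset (nth [::] kindsets j) `<=` kindset (nth [::] kindsets i).
  by rewrite ij.
have := conj sub_ij sub_ji => /andP; apply/implyP.
move: j j12 {ij sub_ij sub_ji}; apply: ltn12_ind; move: i i12.
exact: ltn12_ind.
Qed.

Lemma coversP i j : i < 12 -> j < 12 ->
  covers F (kindset (nth [::] kindsets i)) (kindset (nth [::] kindsets j)) <->
  (i, j) \in hasse_index.
Proof.
move=> i12 j12; rewrite -cover_hasse //; set s := nth _ _ i; set t := nth _ _ j.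
have clone k : k < 12 -> monomial_clone F (kindset (nth [::] kindsets k)).
  move=> k12; apply/monomial_clone_kindset.
  by exists (nth [::] kindsets k); rewrite ?mem_nth.
split=> [[_ _ /kindset_proper st none] | /andP[/kindset_proper st /hasPn none]].
  rewrite /cover st; apply/hasPn => u uK; apply/negP => /andP[su ut].
  apply: none; exists (kindset u); split; try exact/kindset_proper.
  by apply/monomial_clone_kindset; exists u.
split=> //; [exact: clone | exact: clone |].
move=> [_ [/monomial_clone_kindset[u uK ->] /kindset_proper su /kindset_proper ut]].
by have := none u uK; rewrite su ut.
Qed.

End Final.

Theorem proposition3p2 (F : finFieldType) (cardF : #|F| = 4%N) :
  [/\ ([set C | monomial_clone F C] #= `I_12)%card,
      forall C : set monomial, monomial_clone F C <->
        exists2 s, s \in generators & C = generated F [set` s],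
      injective (fun i : 'I_12 => generated F [set` tnth generators i]) &
      forall C D : set monomial, covers F C D <->
        exists2 e, e \in hasse &
          C = generated F [set` e.1] /\ D = generated F [set` e.2]].
Proof.
have cloneP C : monomial_clone F C <->
    exists2 i, i < 12 & C = kindset (nth [::] kindsets i).
  rewrite monomial_clone_kindset //; split=> [[s sK ->] | [i i12 ->]].
    exists (index s kindsets); rewrite ?nth_index //.
    by rewrite -[12]/(size kindsets) index_mem.
  by exists (nth [::] kindsets i); rewrite ?mem_nth.
split.
- have -> : [set C | monomial_clone F C] =
      (fun i => kindset (nth [::] kindsets i)) @` `I_12.
    apply/seteqP; split=> C /=; first by move=> /cloneP[i i12 ->]; exists i.
    by move=> [i i12 <-]; apply/cloneP; exists i.
  apply: inj_card_eq => i j; rewrite !inE; exact: kindset_nth_inj.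
- move=> C; rewrite cloneP; split=> [[i i12 ->] | [s /(nthP [::])[i i12 <-] ->]].
    by exists (nth [::] generators i); rewrite ?mem_nth ?generated_kindset.
  by exists i; rewrite ?generated_kindset.
- move=> i j; rewrite !(tnth_nth [::]) !generated_kindset //.
  by move/kindset_nth_inj => ij; apply/val_inj/ij.
move=> C D; split=> [CD | [e]].
  have [/cloneP[i i12 Ci] /cloneP[j j12 Dj] _ _] := CD.
  move: CD; rewrite {1}Ci {1}Dj coversP // => ijH.
  exists (nth [::] generators i, nth [::] generators j).
    by rewrite hasseE; apply: (map_f _ ijH).
  by rewrite /= !generated_kindset.
rewrite hasseE => /mapP[[i j] ijH ->] /= [-> ->].
have /andP[i12 j12] : (i < 12) && (j < 12).
  have: all (fun e => (e.1 < 12) && (e.2 < 12)) hasse_index by [].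
  by move/allP/(_ _ ijH).
by rewrite !generated_kindset //; apply/coversP.
Qed.
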